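(* Let $I \subseteq A$ and $J \subseteq B$ be monomial ideals, regarded also as ideals of $S = A\otimes_{\mathbbm{k}} B$ via extension. Let $u$ be any positive rational number. Then $$(I+J)_u = \sum_{0 \le \omega \le u,\ \omega \in \mathbb{Q}} I_\omega \cdot J_{u-\omega},$$ where the rational powers $I_\omega$, $J_{u-\omega}$ are extended to $S$ (with $I_0 = A$, $J_0 = B$), and the sum on the right-hand side is a finite sum (i.e., only finitely many distinct ideals $I_\omega J_{u-\omega}$ occur).
   Context: $\mathbbm{k}$ is a field, $A = \mathbbm{k}[X_1,\dots,X_r]$, $B = \mathbbm{k}[Y_1,\dots,Y_s]$, $S = A\otimes_{\mathbbm{k}} B = \mathbbm{k}[X_1,\dots,X_r,Y_1,\dots,Y_s]$. For an ideal $I$ in a domain $R$ and a positive rational $u = p/q$ ($p,q\in\mathbb{N}$, $q\neq 0$), the $u$-th rational power is $I_u = \{x \in R : x^q \in \overline{I^p}\}$, where $\overline{\,\cdot\,}$ denotes integral closure; this does not depend on the representation of $u$. Integral closure of $I$ in $A$ extended to $S$ coincides with the integral closure of $IS$. *)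

(* Defs.v *)
From mathcomp Require Import all_boot all_algebra.
From mathcomp Require Import mpoly.
Set Implicit Arguments.
Unset Strict Implicit.
Unset Printing Implicit Defensive.
Import GRing.Theory Num.Theory.
Local Open Scope ring_scope.

Section Ideals.
Variable R : comRingType.

Definition is_ideal (P : R -> Prop) : Prop :=
  [/\ P 0, (forall x y, P x -> P y -> P (x + y)) & (forall a x, P x -> P (a * x))].

Definition gen_ideal (G : R -> Prop) : R -> Prop :=
  fun x => forall P, is_ideal P -> (forall g, G g -> P g) -> P x.

Definition ideal_mul (I J : R -> Prop) : R -> Prop :=
  gen_ideal (fun x => exists a b, [/\ I a, J b & x = a * b]).

Definition ideal_add (I J : R -> Prop) : R -> Prop :=
  gen_ideal (fun x => I x \/ J x).

Fixpoint ideal_pow (I : R -> Prop) (n : nat) : R -> Prop :=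
  if n is n'.+1 then ideal_mul (ideal_pow I n') I else (fun _ => True).

Definition int_closure (I : R -> Prop) : R -> Prop :=
  fun x => exists (n : nat) (a : nat -> R),
    [/\ (0 < n)%N,
        (forall i, (1 <= i <= n)%N -> ideal_pow I i (a i)) &
        x ^+ n + \sum_(1 <= i < n.+1) a i * x ^+ (n - i) = 0].

Definition rat_power (I : R -> Prop) (u : rat) : R -> Prop :=
  fun x => int_closure (ideal_pow I `|numq u|%N) (x ^+ `|denq u|%N).

Definition same_ideal (I J : R -> Prop) : Prop := forall x, I x <-> J x.

End Ideals.

Definition ideal_ext (A S : comRingType) (f : A -> S) (I : A -> Prop) : S -> Prop :=
  gen_ideal (fun y => exists x, I x /\ y = f x).

Definition monomial_ideal (k : fieldType) (n : nat) (I : {mpoly k[n]} -> Prop) : Prop :=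
  exists G : 'X_{1..n} -> Prop,
    same_ideal I (gen_ideal (fun p => exists m, G m /\ p = 'X_[m])).

(* A = k[X_1..X_r], B = k[Y_1..Y_s] embedded in S = k[X_1..X_r,Y_1..Y_s]
   = {mpoly k[r + s]}: X_i |-> variable i, Y_j |-> variable r + j. *)
Definition embA (k : fieldType) (r s : nat) (p : {mpoly k[r]}) : {mpoly k[r + s]} :=
  mmap (@mpolyC (r + s) k) (fun i : 'I_r => 'X_(lshift s i)) p.
Definition embB (k : fieldType) (r s : nat) (p : {mpoly k[s]}) : {mpoly k[r + s]} :=
  mmap (@mpolyC (r + s) k) (fun j : 'I_s => 'X_(rshift r j)) p.

Definition rp_term (k : fieldType) (r s : nat)
  (I : {mpoly k[r]} -> Prop) (J : {mpoly k[s]} -> Prop) (u w : rat) :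
  {mpoly k[r + s]} -> Prop :=
  ideal_mul (ideal_ext (@embA k r s) (rat_power I w))
            (ideal_ext (@embB k r s) (rat_power J (u - w))).

Definition rp_sum (k : fieldType) (r s : nat)
  (I : {mpoly k[r]} -> Prop) (J : {mpoly k[s]} -> Prop) (u : rat) :
  {mpoly k[r + s]} -> Prop :=
  gen_ideal (fun x => exists w : rat, (0 <= w <= u) /\ rp_term I J u w x).

(* Main.v *)
Require Import Defs.
From HB Require Import structures.
From Stdlib Require Import ClassicalEpsilon.
From mathcomp Require Import all_boot all_order all_algebra.
From mathcomp Require Import mpoly.
From mathcomp Require Import zify ring.
Set Implicit Arguments.
Unset Strict Implicit.
Unset Printing Implicit Defensive.
Import Order.TTheory GRing.Theory Num.Theory.
Local Open Scope ring_scope.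

(* For a monomial ideal I generated by the monomials with exponents in G, a
   polynomial lies in I_w, w = p/q, iff each exponent m of its support
   satisfies: for some N > 0, N q m dominates a sum of N p elements of G.
   "If": the power X^(N q m) is in I^(N p), and I_w is additive because x^q is
   integral over K exactly when x t is integral over the Rees-type ring with
   K^ceil(j/q) in degree j.
   "Only if": an integral equation of degree n for f^q over I^p puts f^(q N) in
   I^(p (N - n)) for all N; passing to leading monomials and comparing two
   values of N with Dickson's lemma gives the condition for the leading
   exponent.
   A sum of generators of I + J splits into a sum of generators of I and one of
   generators of J; the proportion of the former is the exponent w.
   Finiteness: for w <= u the condition on m depends only on the truncation of
   m to a box that is independent of w. *)

(** Subrings are given by [{pred}] and sums are filtered by Booleans, so propositions are decided
    classically. *)
Definition classical_bool (P : Prop) : bool :=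
  if excluded_middle_informative P then true else false.

Lemma classical_boolP (P : Prop) : reflect P (classical_bool P).
Proof.
by rewrite /classical_bool; case: excluded_middle_informative => h; constructor.
Qed.

(** * Generated ideals, their products and powers *)

Section Ideals.
Variable R : comNzRingType.
Implicit Types (I J K : R -> Prop) (x y a b : R).

Lemma gen_ideal_incl (G : R -> Prop) x : G x -> gen_ideal G x.
Proof. by move=> Gx P _; apply. Qed.

Lemma gen_ideal_is_ideal (G : R -> Prop) : is_ideal (gen_ideal G).
Proof.
split=> [P [] //|x y Gx Gy P idP GP|a x Gx P idP GP].
  by case: (idP) => _ PD _; apply: PD; [apply: Gx|apply: Gy].
by case: (idP) => _ _ PM; apply: PM; apply: Gx.
Qed.

Lemma ideal_sum I (T : eqType) (r : seq T) (F : T -> R) : is_ideal I ->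
  (forall t, t \in r -> I (F t)) -> I (\sum_(t <- r) F t).
Proof.
move=> [I0 ID _]; elim: r => [|t r IHr] IF; first by rewrite big_nil.
rewrite big_cons; apply: ID; first by apply: IF; rewrite mem_head.
by apply: IHr => t' t'r; apply: IF; rewrite inE t'r orbT.
Qed.

Lemma ideal_opp I x : is_ideal I -> I x -> I (- x).
Proof. by move=> [_ _ IM] Ix; rewrite -mulN1r; apply: IM. Qed.

Lemma ideal_mulr I x a : is_ideal I -> I x -> I (x * a).
Proof. by move=> [_ _ IM] Ix; rewrite mulrC; apply: IM. Qed.

Lemma ideal_preim_mul I a : is_ideal I -> is_ideal (fun x => I (a * x)).
Proof.
move=> [I0 ID IM]; split=> [|x y|b x]; first by rewrite mulr0.
  by rewrite mulrDr; apply: ID.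
by rewrite mulrCA; apply: IM.
Qed.

Lemma mem_ideal_mul I J a b : I a -> J b -> ideal_mul I J (a * b).
Proof. by move=> Ia Jb; apply: gen_ideal_incl; exists a, b. Qed.

Lemma ideal_mul_subl I J x : is_ideal I -> ideal_mul I J x -> I x.
Proof. by move=> idI; apply=> // _ [a [b [Ia _ ->]]]; apply: ideal_mulr. Qed.

Lemma ideal_pow_is_ideal I n : is_ideal (ideal_pow I n).
Proof. by case: n => [|n]; [split | apply: gen_ideal_is_ideal]. Qed.

Lemma ideal_pow_leq I n m x : (n <= m)%N -> ideal_pow I m x -> ideal_pow I n x.
Proof.
move=> /subnK <-; elim: (m - n)%N => // k IHk Ix; apply: IHk.
exact: ideal_mul_subl (ideal_pow_is_ideal _ _) Ix.
Qed.

Lemma mem_ideal_powD I n m x y :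
  ideal_pow I n x -> ideal_pow I m y -> ideal_pow I (n + m) (x * y).
Proof.
elim: m y => [|m IHm] y Ix Iy.
  by rewrite addn0; apply: ideal_mulr => //; apply: ideal_pow_is_ideal.
rewrite addnS; apply: (Iy (fun y => ideal_pow I (n + m).+1 (x * y))).
  by apply: ideal_preim_mul; apply: (ideal_pow_is_ideal I (n + m).+1).
move=> _ [a [b [Ia Ib ->]]].
by rewrite mulrA; apply: mem_ideal_mul => //; apply: IHm.
Qed.

(** Induction on [m]: with the last factor [b] fixed, membership of [b * y] is an ideal condition on
    [y], so it suffices to test products [y = c * d]. *)
Lemma ideal_powD_sub I n m x :
  ideal_pow I (n + m) x -> ideal_mul (ideal_pow I n) (ideal_pow I m) x.
Proof.
elim: m x => [|m IHm] x.
  by rewrite addn0 => Ix; rewrite -[x]mulr1; apply: mem_ideal_mul.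
rewrite addnS; apply; first exact: gen_ideal_is_ideal.
move=> _ [a [b [/IHm Ia Ib ->]]]; rewrite mulrC.
apply: (Ia (fun y => ideal_mul (ideal_pow I n) (ideal_pow I m.+1) (b * y))).
  exact/ideal_preim_mul/gen_ideal_is_ideal.
move=> _ [c [d [Ic Id ->]]]; rewrite mulrC -mulrA.
by apply: mem_ideal_mul => //; apply: mem_ideal_mul.
Qed.

Lemma ideal_powM I n m x :
  ideal_pow (ideal_pow I n) m x <-> ideal_pow I (n * m) x.
Proof.
split; elim: m x => [|m IHm] x; rewrite ?muln0 ?mulnSr // => Ix.
  apply: Ix => [|_ [a [b [/IHm Ia Ib ->]]]]; first exact: ideal_pow_is_ideal.
  exact: mem_ideal_powD.
apply: (ideal_powD_sub Ix) => [|_ [a [b [/IHm Ia Ib ->]]]].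
  exact: (ideal_pow_is_ideal _ m.+1).
exact: mem_ideal_mul.
Qed.

Lemma gen_ideal_mono (G H : R -> Prop) x :
  (forall y, G y -> H y) -> gen_ideal G x -> gen_ideal H x.
Proof.
move=> GH; apply; first exact: gen_ideal_is_ideal.
by move=> g /GH; apply: gen_ideal_incl.
Qed.

End Ideals.

(** * Integrality over a Rees-type ring *)

(* Here [q = d.+1], and [rees_coef j] is [K^ceil(j/q)]. *)
Section Rees.
Variables (R : comNzRingType) (K : R -> Prop) (d : nat).

Definition rees_coef (j : nat) : R -> Prop := ideal_pow K ((j + d) %/ d.+1).

Definition rees : {pred {poly R}} :=
  fun P => classical_bool (forall j, rees_coef j P`_j).

Lemma reesP (P : {poly R}) : reflect (forall j, rees_coef j P`_j) (P \in rees).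
Proof. exact: classical_boolP. Qed.

(** Rounding up is subadditive, and the powers of an ideal decrease. *)
Lemma rees_coefM i j x y :
  rees_coef i x -> rees_coef j y -> rees_coef (i + j) (x * y).
Proof.
move=> Ix Iy; apply: ideal_pow_leq (mem_ideal_powD Ix Iy).
rewrite -ltnS ltn_divLR //.
have := ltn_ceil (i + d) (ltn0Sn d); have := ltn_ceil (j + d) (ltn0Sn d).
move: (_ %/ _)%N (_ %/ _)%N => e f; nia.
Qed.

Lemma rees_subring_closed : subring_closed rees.
Proof.
split=> [|P Q /reesP PP /reesP QQ|P Q /reesP PP /reesP QQ]; apply/reesP => j.
- rewrite coef1; case: j => [|j] /=; last first.
    by case: (ideal_pow_is_ideal K ((j.+1 + d) %/ d.+1)).
  by rewrite /rees_coef divn_small.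
- rewrite coefB; have idK := ideal_pow_is_ideal K ((j + d) %/ d.+1).
  by case: (idK) => _ KD _; apply: KD; [apply: PP | apply: ideal_opp (QQ j)].
- rewrite coefM; apply: ideal_sum; first exact: ideal_pow_is_ideal.
  move=> i _; rewrite -[j in rees_coef j](subnKC (ltn_ord i : (i <= j)%N)).
  exact: rees_coefM.
Qed.

HB.instance Definition _ := GRing.isSubringClosed.Build {poly R} rees
  rees_subring_closed.

(** Packaged as a ring, so that [integralOver] and its closure under differences and products
    apply. *)
Record rees_ring := ReesElt { rees_val : {poly R}; _ : rees_val \in rees }.

HB.instance Definition _ := [isSub for rees_val].
HB.instance Definition _ := [Choice of rees_ring by <:].
HB.instance Definition _ := [SubChoice_isSubComNzRing of rees_ring by <:].

HB.instance Definition _ :=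
  GRing.RMorphism.copy rees_val (val : rees_ring -> {poly R}).

Lemma rees_coef_mul j : rees_coef (d.+1 * j) = ideal_pow K j.
Proof. by rewrite /rees_coef mulnC divnMDl // divn_small // addn0. Qed.

Lemma mem_rees_monomial j x : rees_coef j x -> x *: 'X^j \in rees.
Proof.
move=> Kx; apply/reesP => i; rewrite coefZ coefXn.
case: eqP => [->|_]; first by rewrite mulr1.
by rewrite mulr0; case: (ideal_pow_is_ideal K ((i + d) %/ d.+1)).
Qed.

(** An equation of degree n for x^q becomes one of degree q n for x t. Conversely (x t)^q is
    integral as well, and the coefficient of t^(q n) in its equation of degree n is an integral
    equation for x^q. *)
Lemma int_closure_rees x :
  int_closure K (x ^+ d.+1) <-> integralOver rees_val (x *: 'X).
Proof.
split=> [[n [a [n0 Ka eqx]]]|].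
  have [b bP] : exists b : nat -> rees_ring, forall i, (1 <= i <= n)%N ->
      rees_val (b i) = a i *: 'X^(d.+1 * i).
    exists (fun i => insubd 0 (a i *: 'X^(d.+1 * i))) => i /Ka Kai.
    by rewrite [LHS]val_insubd mem_rees_monomial // rees_coef_mul.
  (* At x t, [Q] takes the value of the given equation times t^(q n). *)
  pose Q : {poly rees_ring} := 'X^(d.+1 * n) +
     \sum_(1 <= i < n.+1) b i *: 'X^(d.+1 * (n - i)).
  exists Q.
    rewrite monicE lead_coefDl ?lead_coefXn // size_polyXn ltnS.
    rewrite big_nat; apply: (leq_trans (size_sum _ _ _)).
    apply/bigmax_leqP_seq => i _ /andP[i1 _].
    apply: leq_trans (size_scale_leq _ _) _.
    by rewrite size_polyXn ltn_pmul2l //; lia.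
  rewrite /root rmorphD /= map_polyXn rmorph_sum /= hornerD hornerXn.
  rewrite horner_sum big_nat.
  under eq_bigr => i ilt.
    rewrite map_polyZ /= map_polyXn hornerZ hornerXn bP; last lia.
    rewrite exprZn -scalerAl -scalerAr -exprD scalerA -mulnDr.
    rewrite subnKC; last lia.
    rewrite exprM; over.
  rewrite /= -big_nat exprZn exprM.
  rewrite -scaler_suml -scalerDl eqx scale0r.
  by [].
move=> intx; have : integralOver rees_val ((x *: 'X) ^+ d.+1).
  elim: d.+1 => [|e IHe]; first by rewrite expr0; apply: integral1.
  by rewrite exprS; apply: integral_mul.
rewrite exprZn => -[Q /monicP Qmon /eqP].
have szQ : (0 < size Q)%N.
  by rewrite lt0n size_poly_eq0 -lead_coef_eq0 Qmon oner_neq0.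
rewrite horner_coef size_map_inj_poly //; last exact: val_inj.
have [n szQn] : exists n, size Q = n.+1 by case: (size Q) szQ => // n; exists n.
(* In degree q n the i-th term contributes x^(q i) times the coefficient of t^(q (n - i)) in the
   i-th coefficient of [Q], an element of K^(n - i). *)
rewrite szQn => /(congr1 (fun P : {poly R} => P`_(d.+1 * n))).
rewrite coef0 coef_sum.
have Qn1 : Q`_n = 1 by rewrite -Qmon lead_coefE szQn.
under eq_bigr => i _.
  rewrite coef_map exprZn -scalerAr coefZ -(exprM 'X) coefMXn ltn_pmul2l //.
  rewrite ltnNge -ltnS ltn_ord /= -mulnBr.
  over.
rewrite big_ord_recr /= Qn1 subnn muln0 coef1 mulr1 => eqx.
exists n, (fun i => (rees_val Q`_(n - i))`_(d.+1 * i)); split.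
(* In degree 0 the equation would read 1 = 0. *)
- case: n eqx {szQn Qn1} => // ; rewrite big_ord0 add0r expr0 => /eqP.
  by rewrite oner_eq0.
- move=> i _; rewrite -rees_coef_mul; apply: (reesP _ _); exact: valP.
- rewrite addrC -[RHS]eqx; congr (_ + _).
  rewrite big_add1 /= big_mkord (reindex_inj rev_ord_inj) /=.
  apply: eq_bigr => i _; rewrite mulrC.
  have -> : (n - (n - i.+1).+1)%N = i by have := ltn_ord i; lia.
  by have -> : ((n - i.+1).+1 = n - i)%N by have := ltn_ord i; lia.
Qed.

End Rees.

(** * Rational powers of an ideal *)

Section RationalPowers.
Variables (R : comNzRingType) (I : R -> Prop) (u : rat).
Implicit Types x y : R.

(** The purpose of the Rees-type ring: the condition is integrality of x t, which is additive in
    x. *)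
Lemma rat_power_sub x y :
  rat_power I u x -> rat_power I u y -> rat_power I u (x - y).
Proof.
rewrite /rat_power; have: (0 < `|denq u|)%N by rewrite absz_gt0 denq_neq0.
case: `|denq u|%N => // d _ /int_closure_rees Ix /int_closure_rees Iy.
by apply/int_closure_rees; rewrite scalerBl; apply: integral_sub.
Qed.

Lemma rat_power_of_pow N x : (0 < N)%N ->
  ideal_pow I (`|numq u| * N) (x ^+ (`|denq u| * N)) -> rat_power I u x.
Proof.
move=> N0 /ideal_powM IxN.
(* The integral equation is Y^N - x^(q N) = 0 at Y = x^q. *)
exists N, (fun i => if i == N then - x ^+ (`|denq u| * N) else 0); split=> //.
  move=> i _; have idI := ideal_pow_is_ideal (ideal_pow I `|numq u|) i.
  by case: eqP idI => [-> | _ []] // idI; apply: ideal_opp.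
rewrite big_nat_recr //= eqxx subnn mulr1 big_nat big1 => [|i]; last first.
  by case/andP=> _ iN; rewrite ltn_eqF // mul0r.
by rewrite add0r exprM subrr.
Qed.

Lemma rat_power_sum (T : Type) (r : seq T) (P : pred T) (F : T -> R) :
  (forall t, P t -> rat_power I u (F t)) -> rat_power I u (\sum_(t <- r | P t) F t).
Proof.
have I0 : rat_power I u 0.
  apply: (@rat_power_of_pow 1) => //; rewrite !muln1 expr0n.
  rewrite absz_eq0 (negbTE (denq_neq0 u)).
  by case: (ideal_pow_is_ideal I `|numq u|).
move=> IF; apply: big_ind => // x y Ix Iy.
by rewrite -[y]opprK -[- y]sub0r; do 2?apply: rat_power_sub.
Qed.

(** Put y = x^q and K = I^p. By strong induction on [N], the integral equation times y^(N - n)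
    expresses y^N through the a_i y^(N - i), which lie in K^i K^(N - i - n). *)
Lemma rat_power_pow x : rat_power I u x -> exists n, forall N,
  ideal_pow I (`|numq u| * (N - n)) (x ^+ (`|denq u| * N)).
Proof.
case=> n [a [n0 Ia eqx]]; exists n => N; apply/ideal_powM; rewrite exprM.
move: (x ^+ _) (ideal_pow I _) Ia eqx => y K Ka eqy.
elim/ltn_ind: N => N IHN; have [Nn|nN] := ltnP N n.
  by have /eqP -> : (N - n == 0)%N by rewrite subn_eq0 ltnW.
rewrite -{2}(subnK nN) exprD (canRL (addrK _) eqy) sub0r mulrN.
apply: ideal_opp; first exact: ideal_pow_is_ideal.
rewrite mulr_sumr; apply: ideal_sum; first exact: ideal_pow_is_ideal.
move=> i; rewrite mem_index_iota => iP.
have -> : y ^+ (N - n) * (a i * y ^+ (n - i)) = a i * y ^+ (N - i).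
  by rewrite mulrCA -exprD; congr (_ * _ ^+ _); lia.
(* Since subtraction truncates at 0, this exponent may exceed N - n. *)
apply: (@ideal_pow_leq _ _ _ (i + (N - i - n))); first by lia.
by apply: mem_ideal_powD; [apply: Ka | apply: IHN]; lia.
Qed.

End RationalPowers.

(** * Dickson's lemma *)

(** Each index is chosen where [h] attains its minimum over the remaining tail. *)
Lemma nondecreasing_subseq (h : nat -> nat) : exists2 phi : nat -> nat,
  (forall i j, (i < j)%N -> (phi i < phi j)%N) &
  (forall i j, (i <= j)%N -> (h (phi i) <= h (phi j))%N).
Proof.
have ex_min n : exists j, (n <= j)%N /\ forall i, (n <= i)%N -> (h j <= h i)%N.
  suff: forall v k, (n <= k)%N -> (h k <= v)%N ->
    exists j, (n <= j)%N /\ forall i, (n <= i)%N -> (h j <= h i)%N.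
    by move/(_ (h n) n); apply.
  elim=> [|v IHv] k nk hk; first by exists k; split=> // i _; lia.
  have [[i ni hi]|no] := classic (exists2 i, (n <= i)%N & (h i < h k)%N).
    by apply: (IHv i) => //; lia.
  exists k; split=> // i ni; rewrite leqNgt; apply/negP => hi.
  by apply: no; exists i.
pose am n := proj1_sig (constructive_indefinite_description _ (ex_min n)).
have amP n : (n <= am n)%N /\ forall i, (n <= i)%N -> (h (am n) <= h i)%N.
  by rewrite /am; case: constructive_indefinite_description.
pose fix phi k := if k is k'.+1 then am (phi k').+1 else am 0%N.
have phiS k : (phi k < phi k.+1)%N by case: (amP (phi k).+1).
have phi_mono i j : (i < j)%N -> (phi i < phi j)%N.
  elim: j => // j IHj; rewrite ltnS leq_eqVlt => /predU1P [->|/IHj] //.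
  by move=> /ltn_trans; apply.
exists phi => // i j; rewrite leq_eqVlt => /predU1P [->//|/phi_mono ltij].
case: i ltij => [|i] ltij; first by case: (amP 0%N) => _; apply.
by case: (amP (phi i).+1) => le_am; apply; apply: leq_trans (ltnW ltij).
Qed.

Section Dickson.
Variable n : nat.
Implicit Types (G : 'X_{1..n} -> Prop) (L : seq 'X_{1..n}).

(** The coordinates are treated one after another, refining the subsequence each time. *)
Lemma dickson_subseq (f : nat -> 'X_{1..n}) : exists2 phi : nat -> nat,
  (forall i j, (i < j)%N -> (phi i < phi j)%N) &
  (forall i j, (i <= j)%N -> (f (phi i) <= f (phi j))%MM).
Proof.
suff: forall r : seq 'I_n, exists2 phi : nat -> nat,
    (forall i j, (i < j)%N -> (phi i < phi j)%N) &
    (forall i j, (i <= j)%N ->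
       forall t, t \in r -> (f (phi i) t <= f (phi j) t)%N).
  case/(_ (enum 'I_n)) => phi phi_mono phiP; exists phi => // i j /phiP fij.
  by apply/mnm_lepP => t; apply: fij; rewrite mem_enum.
elim=> [|t r [phi phi_mono phiP]]; first by exists id.
have [psi psi_mono psiP] := nondecreasing_subseq (fun i => f (phi i) t).
exists (phi \o psi) => [i j /psi_mono /phi_mono //|i j leij t' /=].
rewrite inE => /predU1P [->|]; first exact: psiP.
apply: phiP; move: leij; rewrite leq_eqVlt => /predU1P [->//|/psi_mono].
exact: ltnW.
Qed.

(** Otherwise elements of [G] can be chosen forever, each above none of its predecessors, against
    [dickson_subseq]. *)
Lemma dickson_basis G : exists2 L : seq 'X_{1..n}, (forall g, g \in L -> G g) &
  (forall g, G g -> exists2 g', g' \in L & (g' <= g)%MM).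
Proof.
apply: NNPP => no_basis.
(* The guard makes the choice total: when [L] is not inside [G], the witness 0 is arbitrary. *)
have ex_new L : exists g, (forall g', g' \in L -> G g') ->
    G g /\ forall g', g' \in L -> ~~ (g' <= g)%MM.
  have [LG|nLG] := classic (forall g, g \in L -> G g); last by exists 0%MM.
  apply: NNPP => no_new; apply: no_basis; exists L => // g Gg.
  apply: NNPP => no_below; apply: no_new; exists g => _; split=> // g' g'L.
  by apply/negP => le_g'g; apply: no_below; exists g'.
pose new L := proj1_sig (constructive_indefinite_description _ (ex_new L)).
have newP L : (forall g', g' \in L -> G g') ->
    G (new L) /\ forall g', g' \in L -> ~~ (g' <= new L)%MM.
  by rewrite /new; case: constructive_indefinite_description.
pose fix pref k := if k is k'.+1 then new (pref k') :: pref k' else [::].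
have prefG k : forall g, g \in pref k -> G g.
  elim: k => // k IHk g; rewrite inE => /predU1P [->|/IHk //].
  by case: (newP _ IHk).
have mem_pref i j : (i < j)%N -> new (pref i) \in pref j.
  elim: j => // j IHj; rewrite ltnS leq_eqVlt => /predU1P [->|/IHj newi].
    by rewrite mem_head.
  by rewrite inE newi orbT.
have [phi phi_mono phiP] := dickson_subseq (new \o pref).
have [_ /(_ _ (mem_pref _ _ (phi_mono 0%N 1%N isT)))] := newP _ (prefG (phi 1%N)).
by rewrite (phiP 0%N 1%N).
Qed.

End Dickson.

(** * Exponents above sums of generators *)

Section SumBelow.
Variable n : nat.
Implicit Types (G : 'X_{1..n} -> Prop) (L : seq 'X_{1..n}) (m : 'X_{1..n}).

(* [m] lies above a sum of [a] elements of [G], counted with repetition. *)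
Fixpoint sum_below G a m : Prop :=
  if a is a'.+1 then
    exists g m', [/\ G g, sum_below G a' m' & (m' + g <= m)%MM]
  else True.

Lemma sum_below_le G a m m' :
  (m <= m')%MM -> sum_below G a m -> sum_below G a m'.
Proof.
case: a => // a le_mm' [g [m0 [Gg Gm0 le_m]]]; exists g, m0; split=> //.
exact: lepm_trans le_m le_mm'.
Qed.

Lemma sum_below_leq G a b m : (b <= a)%N -> sum_below G a m -> sum_below G b m.
Proof.
move=> /subnK <-; elim: (a - b)%N => // k IHk [g [m' [_ Gm' le_m]]]; apply: IHk.
by apply: sum_below_le Gm'; apply: lepm_trans le_m; apply: lem_addr.
Qed.

Lemma sum_belowD G a b m m' :
  sum_below G a m -> sum_below G b m' -> sum_below G (a + b) (m + m')%MM.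
Proof.
elim: b m' => [|b IHb] m' Gm /=.
  by move=> _; rewrite addn0; apply: sum_below_le Gm; apply: lem_addr.
move=> [g [m0 [Gg Gm0 le_m']]]; rewrite addnS /=; exists g, (m + m0)%MM.
split=> //; first exact: IHb.
apply/mnm_lepP => i; move/mnm_lepP/(_ i): le_m'; rewrite !mnmDE; lia.
Qed.

Lemma sum_belowMn G a k m : sum_below G a m -> sum_below G (a * k) (m *+ k)%MM.
Proof.
move=> Gm; elim: k => [|k IHk]; first by rewrite muln0.
by rewrite mulnSr mulmSr; apply: sum_belowD.
Qed.

(** The vector [e] records how often each element of [L] is taken. Being itself an exponent, it is
    subject to Dickson's lemma in turn. *)
Lemma sum_below_linear L G (e : 'X_{1..size L}) : (forall g, g \in L -> G g) ->
  sum_below G (mdeg e) (\sum_(i < size L) nth 0 L i *+ e i)%MM.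
Proof.
move=> LG; rewrite mdegE; elim/big_ind2: _ => // [a m b m'|i _].
  exact: sum_belowD.
rewrite -[X in sum_below _ X]mul1n; apply: sum_belowMn => /=.
by exists (nth 0%MM L i), 0%MM; split; rewrite ?add0m ?lepm_refl //; apply/LG/mem_nth.
Qed.

(** Replacing each summand by a basis element below it keeps the number of summands. *)
Lemma sum_below_basis L G a m :
    (forall g, G g -> exists2 g', g' \in L & (g' <= g)%MM) ->
  sum_below G a m -> exists2 e : 'X_{1..size L}, mdeg e = a &
    (\sum_(i < size L) nth 0 L i *+ e i <= m)%MM.
Proof.
move=> GL; elim: a m => [|a IHa] m /=.
  move=> _; exists 0%MM; first by rewrite mdeg0.
  by apply/mnm_lepP => j; rewrite mnm_sumE big1 // => i _; rewrite mulmnE mnm0E muln0.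
move=> [g [m' [/GL [g' g'L le_g'g] /IHa [e e_deg le_em'] le_m]]].
have ltg' : (index g' L < size L)%N by rewrite index_mem.
exists (e + U_(Ordinal ltg'))%MM; first by rewrite mdegD mdeg1 e_deg addn1.
apply/mnm_lepP => j; move/mnm_lepP/(_ j): le_m; move/mnm_lepP/(_ j): le_em'.
move/mnm_lepP/(_ j): le_g'g; rewrite mnmDE !mnm_sumE => le1 le2 le3.
under eq_bigr do
  rewrite mulmnE mnmDE mnm1E mulnDr -mulmnE.
rewrite big_split /= [X in (_ + X <= _)%N](bigD1 (Ordinal ltg')) //= eqxx muln1.
rewrite nth_index // [X in (_ + (_ + X) <= _)%N]big1 => [|i].
  by rewrite addn0; apply: leq_trans le3; apply: leq_add.
by rewrite eq_sym => /negbTE ->; rewrite muln0.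
Qed.

(* Almost integrality implies integrality: compare two members of a Dickson
   subsequence of the slacks and of the coefficient vectors. *)
Lemma sum_below_asymptotic G p q k m :
  (forall N, sum_below G (p * (N - k)) (m *+ (q * N))%MM) ->
  exists2 N, (0 < N)%N & sum_below G (p * N) (m *+ (q * N))%MM.
Proof.
move=> Gm; have [L LG GL] := dickson_basis G.
pose lin (e : 'X_{1..size L}) := (\sum_(i < size L) nth 0 L i *+ e i)%MM.
(* Taking N = k + i turns N - k into i. *)
have ex_e i : exists e, mdeg e = (p * i)%N /\ (lin e <= m *+ (q * (k + i)))%MM.
  have := Gm (k + i)%N; rewrite addKn => /(sum_below_basis GL) [e e_deg le_e].
  by exists e.
pose e i := proj1_sig (constructive_indefinite_description _ (ex_e i)).
have eP i : mdeg (e i) = (p * i)%N /\ (lin (e i) <= m *+ (q * (k + i)))%MM.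
  by rewrite /e; case: constructive_indefinite_description.
(* First the slacks, then the multiplicity vectors are made nondecreasing. *)
have [phi phi_mono phiP] := dickson_subseq (fun i => m *+ (q * (k + i)) - lin (e i))%MM.
have [psi psi_mono psiP] := dickson_subseq (e \o phi).
have := phi_mono _ _ (psi_mono 0%N 1%N isT).
have := phiP _ _ (ltnW (psi_mono 0%N 1%N isT)); have /= := psiP 0%N 1%N isT.
move: (phi (psi 0%N)) (phi (psi 1%N)) => i j le_e le_slack lt_ij.
have [deg_i le_i] := eP i; have [deg_j le_j] := eP j.
(* Subtracting the data at i from those at j cancels the shift k: as the slack does not decrease, p
   (j - i) generators fit below q (j - i) m. *)
exists (j - i)%N; first by rewrite subn_gt0.
have eE := submK le_e.
have deg_ji : mdeg (e j - e i)%MM = (p * (j - i))%N.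
  by move: (congr1 mdeg eE); rewrite mdegD deg_i deg_j mulnBr; lia.
have lin_ji : (lin (e j) = lin (e j - e i) + lin (e i))%MM.
  rewrite -{1}eE /lin -big_split /=; apply: eq_bigr => t _.
  by apply/mnmP => c; rewrite [RHS]mnmDE !mulmnE mnmDE mulnDr.
rewrite -deg_ji; apply: sum_below_le (sum_below_linear _ LG); apply/mnm_lepP => c.
rewrite -/(lin _).
move/mnm_lepP/(_ c): le_i; move/mnm_lepP/(_ c): le_j.
move/mnm_lepP/(_ c): le_slack; rewrite lin_ji !mnmBE !mnmDE !mulmnE; nia.
Qed.

End SumBelow.

(** * Rational multiples of the Newton polyhedron *)

Section RatBelow.
Variable n : nat.
Implicit Types (G : 'X_{1..n} -> Prop) (m : 'X_{1..n}) (w : rat).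

(* [m] lies in [w] times the Newton polyhedron of the ideal generated by [G]. *)
Definition rat_below G w m : Prop :=
  exists2 N, (0 < N)%N & sum_below G (`|numq w| * N) (m *+ (`|denq w| * N))%MM.

Lemma rat_below_le G w m m' :
  (m <= m')%MM -> rat_below G w m -> rat_below G w m'.
Proof.
move=> le_mm' [N N0 Gm]; exists N => //; apply: sum_below_le Gm.
by apply/mnm_lepP => i; rewrite !mulmnE leq_mul2r (mnm_lepP le_mm') orbT.
Qed.

Lemma rat_fracE w : 0 <= w -> w = `|numq w|%N%:R / `|denq w|%N%:R.
Proof.
move=> w0; rewrite -[LHS]divq_num_den.
have -> : (numq w)%:~R = `|numq w|%N%:R :> rat.
  by rewrite [RHS]pmulrn gez0_abs // numq_ge0.
by have -> : (denq w)%:~R = `|denq w|%N%:R :> rat by rewrite [RHS]pmulrn absz_denq.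
Qed.

(** Any fraction a/b >= w may replace the reduced one p/q, which avoids computing numerators of sums
    and differences. Indeed q copies of the sum provide q a >= p b generators below q b m. *)
Lemma rat_belowP G w m : 0 <= w ->
  rat_below G w m <-> exists a b, [/\ (0 < b)%N, w * b%:R <= a%:R :> rat
                                   & sum_below G a (m *+ b)%MM].
Proof.
move=> w0; have q0 : (0 < `|denq w|)%N by rewrite absz_gt0 denq_neq0.
have q0' : `|denq w|%N%:R != 0 :> rat by rewrite pnatr_eq0 -lt0n.
split=> [[N N0 Gm]|[a [b [b0 le_wa Gm]]]].
  exists (`|numq w| * N)%N, (`|denq w| * N)%N; split=> //; first by rewrite muln_gt0 q0.
  by rewrite {1}(rat_fracE w0) !natrM mulrA divfK.
exists b => //; have := sum_belowMn `|denq w| Gm.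
have -> : (m *+ b *+ `|denq w| = m *+ (`|denq w| * b))%MM.
  by apply/mnmP => i; rewrite !mulmnE -mulnA (mulnC b).
apply: sum_below_leq; rewrite -(ler_nat rat) !natrM.
move: le_wa; rewrite {1}(rat_fracE w0) mulrAC ler_pdivrMr //.
by rewrite ltr0n.
Qed.

(* A sum of elements of a finite basis grows at a bounded rate in each
   coordinate, so only the truncation of [m] to a box matters. *)
Lemma rat_below_trunc G u : exists B, forall w m, 0 <= w <= u ->
  rat_below G w m <-> rat_below G w [multinom minn (m i) B | i < n]%MM.
Proof.
have [L LG GL] := dickson_basis G.
(* [D] bounds every coordinate of every basis element. For w = p/q, a sum of p N of them has
   coordinates at most D p N, hence at most B q N, because w <= u and u is at most its numerator. *)
pose D := (\sum_(g <- L) mdeg g)%N; pose B := (D * `|numq u|)%N.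
exists B => w m /andP[w0 wu]; split; last first.
  by apply: rat_below_le; apply/mnm_lepP => i; rewrite mnmE geq_minl.
have u0 : 0 <= u by apply: le_trans wu.
case=> N N0 /(sum_below_basis GL) [e deg_e le_e]; exists N => //.
rewrite -deg_e; apply: sum_below_le (sum_below_linear _ LG).
apply/mnm_lepP => i; rewrite mulmnE mnmE minnMl leq_min.
move/mnm_lepP/(_ i): le_e; rewrite mulmnE => -> /=.
rewrite mnm_sumE; apply: (@leq_trans (\sum_(j < size L) D * e j)%N).
  apply: leq_sum => j _; rewrite mulmnE leq_mul2r; apply/orP; right.
  rewrite /D (big_nth 0%MM) big_mkord (bigD1 j) //= mdegE (bigD1 i) //=.
  by rewrite -addnA leq_addr.
rewrite -big_distrr /= -mdegE deg_e /B -mulnA leq_mul2l; apply/orP; right.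
rewrite mulnA leq_mul2r; apply/orP; right.
have le_num_u : u <= `|numq u|%N%:R.
  rewrite {1}(rat_fracE u0) ler_pdivrMr ?ltr0n ?absz_gt0 ?denq_neq0 //.
  by rewrite -natrM ler_nat leq_pmulr // absz_gt0 denq_neq0.
rewrite -(ler_nat rat) natrM -ler_pdivrMr ?ltr0n ?absz_gt0 ?denq_neq0 //.
by rewrite -rat_fracE //; apply: le_trans wu le_num_u.
Qed.

End RatBelow.

(** * Monomial ideals described by supports *)

Section MonomialIdeals.
Variables (k : fieldType) (n : nat).
Implicit Types (P : 'X_{1..n} -> Prop) (f : {mpoly k[n]}) (m : 'X_{1..n}).

Definition supp_in P f : Prop := forall m, m \in msupp f -> P m.

Lemma supp_in_mul P Q T f g :
    (forall m m', P m -> Q m' -> T (m + m')%MM) ->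
  supp_in P f -> supp_in Q g -> supp_in T (f * g).
Proof.
move=> PQT Pf Qg m /msuppM_le /allpairsP [[m1 m2] /= [/Pf Pm1 /Qg Qm2 ->]].
exact: PQT.
Qed.

Lemma supp_in_ideal P :
  (forall m m', (m <= m')%MM -> P m -> P m') -> is_ideal (supp_in P).
Proof.
move=> Pup; split=> [m|f g Pf Pg m|g f Pf]; first by rewrite msupp0.
  by move/msuppD_le; rewrite mem_cat => /orP [/Pf|/Pg].
apply: (@supp_in_mul xpredT P) => // m m' _; apply: Pup; exact: lem_addl.
Qed.

Lemma supp_inX P m : supp_in P 'X_[m] <-> P m.
Proof.
split=> [|Pm m']; first by apply; rewrite msuppX mem_head.
by rewrite msuppX inE => /eqP ->.
Qed.

Lemma ideal_monomials (I : {mpoly k[n]} -> Prop) P f :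
  is_ideal I -> (forall m, P m -> I 'X_[m]) -> supp_in P f -> I f.
Proof.
move=> idI PI Pf; rewrite [f]mpolyE; apply: ideal_sum => // m /Pf /PI Im.
by case: idI => _ _ IM; rewrite -mul_mpolyC; apply: IM.
Qed.

Variables (I : {mpoly k[n]} -> Prop) (G : 'X_{1..n} -> Prop).
Hypothesis IG : same_ideal I (gen_ideal (fun p => exists m, G m /\ p = 'X_[m])).

(** One inclusion holds because exponents of a product are sums of exponents of the factors; the
    other reduces to monomials by [ideal_monomials]. *)
Lemma monomial_ideal_pow a f : ideal_pow I a f <-> supp_in (sum_below G a) f.
Proof.
split.
  elim: a f => // a IHa f; apply=> [|_ [x [y [/IHa Gx /IG Gy ->]]]].
    by apply: supp_in_ideal => m m'; apply: sum_below_le.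
  pose above m := exists2 g, G g & (g <= m)%MM.
  have {Gy} : supp_in above y.
    apply: Gy => [|_ [g [Gg ->]]]; last by apply/supp_inX; exists g; rewrite ?lepm_refl.
    apply: supp_in_ideal => m m' le_mm' [g Gg le_gm].
    by exists g => //; apply: lepm_trans le_mm'.
  apply: supp_in_mul Gx => m m' Gm [g Gg le_gm']; exists g, m; split=> //.
  by apply/mnm_lepP => i; rewrite !mnmDE leq_add2l (mnm_lepP le_gm').
apply: ideal_monomials; first exact: ideal_pow_is_ideal.
elim: a => // a IHa m [g [m' [Gg /IHa Im' le_m]]].
rewrite -(submK le_m) mpolyXD.
case: (ideal_pow_is_ideal I a.+1) => _ _; apply.
rewrite mpolyXD; apply: mem_ideal_mul => //.
by apply/IG; apply: gen_ideal_incl; exists g.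
Qed.

Lemma rat_power_monomial w c m : rat_below G w m -> rat_power I w (c *: 'X_[m]).
Proof.
case=> N N0 Gm; apply: (rat_power_of_pow N0); rewrite exprZn mpolyXn.
apply/monomial_ideal_pow => m' /msuppZ_le; rewrite msuppX inE => /eqP ->.
exact: Gm.
Qed.

(** The exponent q N [mlead f] cannot cancel in f^(q N), its coefficient being a power of the
    leading one. [sum_below_asymptotic] then removes the shift [n0]. *)
Lemma rat_power_mlead w f : f != 0 -> rat_power I w f -> rat_below G w (mlead f).
Proof.
move=> f0 /rat_power_pow [n0 In0]; apply: (sum_below_asymptotic (k := n0)) => N.
have /monomial_ideal_pow := In0 N; apply.
by rewrite mcoeff_msupp mleadcX expf_neq0 // mleadc_eq0.
Qed.

(* Removing from [f] the monomials already known to lie in the rational power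
   leaves an element of it; were that nonzero, its leading monomial would be
   one of those removed. *)
Lemma monomial_rat_power w f : rat_power I w f <-> supp_in (rat_below G w) f.
Proof.
pose good m := classical_bool (rat_below G w m).
have Igood (r : seq 'X_{1..n}) (c : 'X_{1..n} -> k) :
    rat_power I w (\sum_(m <- r | good m) c m *: 'X_[m]).
  by apply: rat_power_sum => m /classical_boolP; apply: rat_power_monomial.
split=> [If m mf|Gf]; last first.
  have := Igood (msupp f) (fun m => f@_m).
  rewrite big_mkcond big_seq_cond (eq_bigr (fun m => f@_m *: 'X_[m])) => [|m].
    by rewrite -big_seq_cond -mpolyE.
  by rewrite andbT => /Gf /classical_boolP; rewrite /good => ->.
apply/classical_boolP/negPn/negP => not_good.
pose g := f - \sum_(m <- msupp f | good m) f@_m *: 'X_[m].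
have gE : g = \sum_(m <- msupp f | ~~ good m) f@_m *: 'X_[m].
  by rewrite /g {1}[f]mpolyE (bigID good) /= addrC addrK.
have gcoef m' : g@_m' = if good m' then 0 else f@_m'.
  rewrite gE raddf_sum /=.
  under eq_bigr do rewrite mcoeffZ mcoeffX.
  have [m'f|m'f] := boolP (m' \in msupp f); last first.
    rewrite (memN_msupp_eq0 m'f) if_same big_seq_cond big1 // => m1.
    case/andP => m1f _; case: eqP m'f => [<-|_ _]; first by rewrite m1f.
    by rewrite mulr0.
  case: ifP => gm'.
    rewrite big1 // => m1 ngm1; case: eqP => [eq_m1|_]; last by rewrite mulr0.
    by rewrite eq_m1 gm' in ngm1.
  rewrite big_mkcond (bigD1_seq m') ?msupp_uniq //= gm' eqxx mulr1 big1 ?addr0 //.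
  by move=> m1 /negbTE ->; rewrite mulr0 if_same.
have g0 : g != 0.
  apply/eqP => /(congr1 (mcoeff m)); rewrite gcoef /good (negbTE not_good) mcoeff0.
  by move/eqP; rewrite -[_ == 0]negbK -mcoeff_msupp mf.
have /(rat_power_mlead g0) /classical_boolP : rat_power I w g by apply: rat_power_sub.
rewrite -/(good _) => glead.
have := mleadc_eq0 g; rewrite gcoef glead eqxx => /esym /eqP g_eq0.
by rewrite g_eq0 eqxx in g0.
Qed.

End MonomialIdeals.

(** * Splitting exponents between the two sets of variables *)

Section Join.
Variables r s : nat.
Implicit Types (x : 'X_{1..r}) (y : 'X_{1..s}) (m : 'X_{1..r + s}).

Definition mjoin x y : 'X_{1..r + s} :=
  [multinom match split i with inl j => x j | inr j => y j end | i < r + s]%MM.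

Definition mleft m : 'X_{1..r} := [multinom m (lshift s i) | i < r]%MM.
Definition mright m : 'X_{1..s} := [multinom m (rshift r i) | i < s]%MM.

Lemma mjoinl x y i : mjoin x y (lshift s i) = x i.
Proof. by rewrite mnmE -[lshift s i]/(unsplit (inl i)) unsplitK. Qed.

Lemma mjoinr x y i : mjoin x y (rshift r i) = y i.
Proof. by rewrite mnmE -[rshift r i]/(unsplit (inr i)) unsplitK. Qed.

Lemma mjoinK m : mjoin (mleft m) (mright m) = m.
Proof.
by apply/mnmP => i; case: (split_ordP i) => j ->; rewrite ?mjoinl ?mjoinr mnmE.
Qed.

Lemma mjoinD x x' y y' : mjoin (x + x')%MM (y + y')%MM = (mjoin x y + mjoin x' y')%MM.
Proof.
by apply/mnmP => i; case: (split_ordP i) => j ->; rewrite mnmDE ?mjoinl ?mjoinr mnmDE.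
Qed.

Lemma mleft_join x y : mleft (mjoin x y) = x.
Proof. by apply/mnmP => i; rewrite mnmE mjoinl. Qed.

Lemma mright_join x y : mright (mjoin x y) = y.
Proof. by apply/mnmP => i; rewrite mnmE mjoinr. Qed.

Lemma mleft_le m m' : (m <= m')%MM -> (mleft m <= mleft m')%MM.
Proof. by move/mnm_lepP => le; apply/mnm_lepP => i; rewrite !mnmE. Qed.

Lemma mright_le m m' : (m <= m')%MM -> (mright m <= mright m')%MM.
Proof. by move/mnm_lepP => le; apply/mnm_lepP => i; rewrite !mnmE. Qed.

Lemma mleftD m m' : mleft (m + m')%MM = (mleft m + mleft m')%MM.
Proof. by apply/mnmP => i; rewrite mnmDE !mnmE. Qed.

Lemma mrightD m m' : mright (m + m')%MM = (mright m + mright m')%MM.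
Proof. by apply/mnmP => i; rewrite mnmDE !mnmE. Qed.

Lemma mleftMn m a : mleft (m *+ a)%MM = (mleft m *+ a)%MM.
Proof. by apply/mnmP => i; rewrite mulmnE !mnmE mulmnE. Qed.

Lemma mrightMn m a : mright (m *+ a)%MM = (mright m *+ a)%MM.
Proof. by apply/mnmP => i; rewrite mulmnE !mnmE mulmnE. Qed.

Variables (G : 'X_{1..r} -> Prop) (H : 'X_{1..s} -> Prop).

(** Exponents of the monomial generators of I + J in S. *)
Definition join_gens m : Prop :=
  (exists2 g, G g & m = mjoin g 0%MM) \/ (exists2 h, H h & m = mjoin 0%MM h).

(** Each generator lives in one block of coordinates; [b] and [c] count the two kinds. Conversely,
    both sums are padded with zeros and added. *)
Lemma sum_below_join a m : sum_below join_gens a m <->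
  exists b c, [/\ (b + c = a)%N, sum_below G b (mleft m) & sum_below H c (mright m)].
Proof.
split.
  elim: a m => [|a IHa] m; first by exists 0%N, 0%N.
  move=> [g [m' [Gg /IHa [b [c [<- Gm' Hm']]] le_m]]].
  have := mleft_le le_m; have := mright_le le_m; rewrite mleftD mrightD.
  case: Gg => [[x Gx ->]|[y Hy ->]]; rewrite mleft_join mright_join => ler lel.
    exists b.+1, c; split=> //; first by exists x, (mleft m').
    by apply: sum_below_le Hm'; rewrite addm0 in ler.
  exists b, c.+1; split=> //; first by rewrite addnS.
    by apply: sum_below_le Gm'; rewrite addm0 in lel.
  by exists y, (mright m').
have left b x : sum_below G b x -> sum_below join_gens b (mjoin x 0%MM).
  elim: b x => // b IHb x [g [x' [Gg /IHb Gx' le_x]]].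
  exists (mjoin g 0%MM), (mjoin x' 0%MM); split=> //; first by left; exists g.
  rewrite -mjoinD addm0; apply/mnm_lepP => i.
  by case: (split_ordP i) => j ->; rewrite ?mjoinl ?mjoinr ?(mnm_lepP le_x).
have right c y : sum_below H c y -> sum_below join_gens c (mjoin 0%MM y).
  elim: c y => // c IHc y [h [y' [Hh /IHc Hy' le_y]]].
  exists (mjoin 0%MM h), (mjoin 0%MM y'); split=> //; first by right; exists h.
  rewrite -mjoinD addm0; apply/mnm_lepP => i.
  by case: (split_ordP i) => j ->; rewrite ?mjoinl ?mjoinr ?(mnm_lepP le_y).
move=> [b [c [<- /left Gm /right Hm]]].
by have := sum_belowD Gm Hm; rewrite -mjoinD addm0 add0m mjoinK.
Qed.

Lemma rat_below_join u m : 0 <= u -> rat_below join_gens u m <->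
  exists2 w, 0 <= w <= u &
    rat_below G w (mleft m) /\ rat_below H (u - w) (mright m).
Proof.
move=> u0; split.
  case/(rat_belowP _ _ u0) => a [b [b0 le_ua /sum_below_join]].
  case=> c [d [def_a]]; rewrite mleftMn mrightMn => Gm Hm.
  have b0' : 0 < b%:R :> rat by rewrite ltr0n.
  (* If c/b <= u, it serves as w, and c + d >= u b leaves d >= (u - w) b. *)
  have [le_cu|lt_uc] := leP (c%:R / b%:R) u.
    exists (c%:R / b%:R); first by rewrite divr_ge0.
    split; apply/rat_belowP; rewrite ?divr_ge0 ?subr_ge0 //.
      by exists c, b; split=> //; rewrite divfK // gt_eqF.
    exists d, b; split=> //; rewrite mulrBl divfK ?gt_eqF // lerBlDr.
    by rewrite -natrD addnC def_a.
  (* With c/b > u, w = u suffices and the second condition asks for 0 generators. *)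
  exists u; first by rewrite u0 lexx.
  split; apply/rat_belowP; rewrite ?subr_ge0 //.
    by exists c, b; split=> //; rewrite -ler_pdivlMr // ltW.
  by exists 0%N, 1%N; split=> //; rewrite subrr mul0r.
case=> w /andP[w0 wu] [/(rat_belowP _ _ w0) [a [b [b0 le_a Gm]]]].
have uw0 : 0 <= u - w by rewrite subr_ge0.
case/(rat_belowP _ _ uw0) => c [d [d0 le_c Hm]].
(* Both fractions are brought to the common denominator b d. *)
apply/(rat_belowP _ _ u0); exists (a * d + c * b)%N, (b * d)%N; split.
- by rewrite muln_gt0 b0.
- rewrite natrD !natrM.
  have d0' : 0 <= d%:R :> rat by rewrite ler0n.
  have b0' : 0 <= b%:R :> rat by rewrite ler0n.
  have := lerD (ler_wpM2r d0' le_a) (ler_wpM2r b0' le_c).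
  by apply: le_trans; rewrite le_eqVlt; apply/orP; left; apply/eqP; ring.
apply/sum_below_join; exists (a * d)%N, (c * b)%N; split=> //.
  have := sum_belowMn d Gm; congr (sum_below _ _ _).
  by apply/mnmP => i; rewrite !mulmnE !mnmE !mulmnE mulnA.
have := sum_belowMn b Hm; congr (sum_below _ _ _).
by apply/mnmP => i; rewrite !mulmnE !mnmE !mulmnE -mulnA (mulnC d).
Qed.

End Join.

(** * Extension of ideals to the joint polynomial ring *)

Lemma ideal_preim (A S : comNzRingType) (f : {rmorphism A -> S}) (P : S -> Prop) :
  is_ideal P -> is_ideal (fun x => P (f x)).
Proof.
move=> [P0 PD PM]; split=> [|x y Px Py|a x Px]; first by rewrite rmorph0.
  by rewrite rmorphD; apply: PD.
by rewrite rmorphM; apply: PM.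
Qed.

Section Embeddings.
Variables (k : fieldType) (r s : nat).
Local Notation eA := (@embA k r s).
Local Notation eB := (@embB k r s).

Lemma embAX x : eA 'X_[x] = 'X_[mjoin x 0%MM].
Proof.
rewrite /embA mmapX /mmap1 mprodXnE; congr mpolyX; apply/mnmP => i.
rewrite mnm_sumE; case: (split_ordP i) => j ->; rewrite ?mjoinl ?mjoinr.
  rewrite (bigD1 j) //= mulmnE mnm1E eqxx mul1n big1 ?addn0 // => t /negbTE tj.
  by rewrite mulmnE mnm1E eq_lshift tj.
by rewrite mnm0E big1 // => t _; rewrite mulmnE mnm1E eq_lrshift.
Qed.

Lemma embBX y : eB 'X_[y] = 'X_[mjoin 0%MM y].
Proof.
rewrite /embB mmapX /mmap1 mprodXnE; congr mpolyX; apply/mnmP => i.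
rewrite mnm_sumE; case: (split_ordP i) => j ->; rewrite ?mjoinl ?mjoinr.
  by rewrite mnm0E big1 // => t _; rewrite mulmnE mnm1E eq_rlshift.
rewrite (bigD1 j) //= mulmnE mnm1E eqxx mul1n big1 ?addn0 // => t /negbTE tj.
by rewrite mulmnE mnm1E eq_rshift tj.
Qed.

(** As ring morphisms, the embeddings pull ideals back by [ideal_preim]. *)
HB.instance Definition _ := GRing.RMorphism.copy eA
  (mmap (@mpolyC (r + s) k) (fun i : 'I_r => 'X_(lshift s i))).
HB.instance Definition _ := GRing.RMorphism.copy eB
  (mmap (@mpolyC (r + s) k) (fun j : 'I_s => 'X_(rshift r j))).

Lemma embA_supp P f : supp_in P f ->
  supp_in (fun m => P (mleft m)) (eA f).
Proof.
move=> Pf m; rewrite /embA /mmap => /msupp_sum_le /flatten_mapP [x].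
rewrite filter_predT => xf; rewrite mul_mpolyC => /msuppZ_le.
move: (embAX x); rewrite /embA mmapX => ->; rewrite msuppX inE => /eqP ->.
by rewrite mleft_join; apply: Pf.
Qed.

Lemma embB_supp P f : supp_in P f ->
  supp_in (fun m => P (mright m)) (eB f).
Proof.
move=> Pf m; rewrite /embB /mmap => /msupp_sum_le /flatten_mapP [x].
rewrite filter_predT => xf; rewrite mul_mpolyC => /msuppZ_le.
move: (embBX x); rewrite /embB mmapX => ->; rewrite msuppX inE => /eqP ->.
by rewrite mright_join; apply: Pf.
Qed.

Variables (I : {mpoly k[r]} -> Prop) (J : {mpoly k[s]} -> Prop).
Variables (G : 'X_{1..r} -> Prop) (H : 'X_{1..s} -> Prop).
Hypothesis IG : same_ideal I (gen_ideal (fun p => exists m, G m /\ p = 'X_[m])).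
Hypothesis JH : same_ideal J (gen_ideal (fun p => exists m, H m /\ p = 'X_[m])).

(** Lets [monomial_rat_power] be applied to I + J. *)
Lemma ideal_add_monomial :
  same_ideal (ideal_add (ideal_ext eA I) (ideal_ext eB J))
    (gen_ideal (fun p => exists m, join_gens G H m /\ p = 'X_[m])).
Proof.
have gid := gen_ideal_is_ideal.
move=> f; split; apply; [exact: gid | | exact: gid |].
  move=> g [] ext; apply: ext => // {g} _ [x [Ix ->]].
    move/IG: Ix => Ix; apply: (Ix (fun x => gen_ideal _ (eA x))).
      exact: ideal_preim.
    move=> _ [g [Gg ->]]; apply: gen_ideal_incl; exists (mjoin g 0%MM).
    by split; [left; exists g | rewrite embAX].
  move/JH: Ix => Jx; apply: (Jx (fun x => gen_ideal _ (eB x))).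
    exact: ideal_preim.
  move=> _ [h [Hh ->]]; apply: gen_ideal_incl; exists (mjoin 0%MM h).
  by split; [right; exists h | rewrite embBX].
move=> _ [m [[[g Gg ->]|[h Hh ->]] ->]]; apply: gen_ideal_incl.
  left; apply: gen_ideal_incl; exists 'X_[g]; rewrite embAX; split=> //.
  by apply/IG; apply: gen_ideal_incl; exists g.
right; apply: gen_ideal_incl; exists 'X_[h]; rewrite embBX; split=> //.
by apply/JH; apply: gen_ideal_incl; exists h.
Qed.

Lemma rp_term_supp u w f : 0 <= w <= u -> rp_term I J u w f ->
  supp_in (rat_below (join_gens G H) u) f.
Proof.
move=> wP; have u0 : 0 <= u by case/andP: wP; apply: le_trans.
apply=> [|_ [a [b [Ia Jb ->]]]].
  by apply: supp_in_ideal => m m'; apply: rat_below_le.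
have {Ia} : supp_in (fun m => rat_below G w (mleft m)) a.
  apply: Ia => [|_ [x [/(monomial_rat_power IG) Gx ->]]]; last exact: embA_supp.
  by apply: supp_in_ideal => m m' /mleft_le; apply: rat_below_le.
have {Jb} : supp_in (fun m => rat_below H (u - w) (mright m)) b.
  apply: Jb => [|_ [x [/(monomial_rat_power JH) Hx ->]]]; last exact: embB_supp.
  by apply: supp_in_ideal => m m' /mright_le; apply: rat_below_le.
(* The left block is controlled by [a] and the right block by [b]; the other factor only enlarges
   each of them. *)
move=> Hb Ga; apply: supp_in_mul Ga Hb => m m' Gm Hm'.
apply/rat_below_join => //; exists w => //; split.
  by apply: rat_below_le Gm; apply/mleft_le/lem_addr.
by apply: rat_below_le Hm'; apply/mright_le/lem_addl.
Qed.

(** This is the exponent set of (I + J)_u. A monomial in it is its left part times its right part,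
    with w supplied by [rat_below_join]. *)
Lemma rp_sum_monomial u f : 0 <= u ->
  rp_sum I J u f <-> supp_in (rat_below (join_gens G H) u) f.
Proof.
move=> u0; split.
  apply=> [|g [w [wP]]]; last exact: rp_term_supp.
  by apply: supp_in_ideal => m m'; apply: rat_below_le.
apply: ideal_monomials; first exact: gen_ideal_is_ideal.
move=> m /(rat_below_join _ _ _ u0) [w wP [Gm Hm]].
apply: gen_ideal_incl; exists w; split=> //.
have -> : 'X_[m] = eA 'X_[mleft m] * eB 'X_[mright m].
  by rewrite embAX embBX -mpolyXD -mjoinD addm0 add0m mjoinK.
apply: mem_ideal_mul; apply: gen_ideal_incl.
  by exists 'X_[mleft m]; split=> //; apply/(monomial_rat_power IG)/supp_inX.
by exists 'X_[mright m]; split=> //; apply/(monomial_rat_power JH)/supp_inX.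
Qed.

(** A term depends on w only through two exponent sets, which reduces finiteness to those sets. *)
Lemma rp_term_sub u w w' f :
    (forall m, rat_below G w m -> rat_below G w' m) ->
    (forall m, rat_below H (u - w) m -> rat_below H (u - w') m) ->
  rp_term I J u w f -> rp_term I J u w' f.
Proof.
move=> Gw Hw; apply: gen_ideal_mono => _ [a [b [Ia Jb ->]]].
exists a, b; split; [move: Ia | move: Jb | by []];
  apply: gen_ideal_mono => _ [x [Ix ->]]; exists x; (split; last by []);
  move: Ix.
  by move/(monomial_rat_power IG) => Gx; apply/(monomial_rat_power IG) => m /Gx /Gw.
by move/(monomial_rat_power JH) => Hx; apply/(monomial_rat_power JH) => m /Hx /Hw.
Qed.

End Embeddings.

(** * Finiteness of the family of terms *)

(** Induction on a list of values of [code]: each value attained on [P] receives one representative,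
    found classically. *)
Lemma finite_representatives (W : eqType) (T : finType) (P : W -> Prop) (code : W -> T) :
  exists ws : seq W, (forall w, w \in ws -> P w) /\
    forall w, P w -> exists2 w', w' \in ws & code w = code w'.
Proof.
suff: forall r : seq T, exists ws : seq W, (forall w, w \in ws -> P w) /\
    forall w, P w -> code w \in r -> exists2 w', w' \in ws & code w = code w'.
  case/(_ (enum T)) => ws [wsP ws_rep]; exists ws; split=> // w Pw.
  by apply: ws_rep => //; rewrite mem_enum.
elim=> [|t r [ws [wsP ws_rep]]]; first by exists [::].
have [[w0 Pw0 code_w0]|no_w] := classic (exists2 w, P w & code w = t).
  exists (w0 :: ws); split=> [w|w Pw]; rewrite inE => /predU1P [->//|wr].
  - exact: wsP.
  - by exists w0; rewrite ?mem_head.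
  - by have [w' w'ws ->] := ws_rep _ Pw wr; exists w'; rewrite // inE w'ws orbT.
exists ws; split=> // w Pw; rewrite inE => /predU1P [wt|]; last exact: ws_rep.
by case: no_w; exists w.
Qed.

(** The code of w is the set of box points it admits; by [rat_below_trunc] one box serves all w in
    [0, u]. *)
Lemma rat_below_finite n (G : 'X_{1..n} -> Prop) u : exists T : finType,
  exists code : rat -> T, forall w w', 0 <= w <= u -> 0 <= w' <= u ->
    code w = code w' -> forall m, rat_below G w m -> rat_below G w' m.
Proof.
have [B truncB] := rat_below_trunc G u.
pose box (t : {ffun 'I_n -> 'I_B.+1}) := [multinom (t i : nat) | i < n]%MM.
exists {set {ffun 'I_n -> 'I_B.+1}}.
exists (fun w => [set t | classical_bool (rat_below G w (box t))]).
move=> w w' wP w'P /setP eq_ww' m /(truncB _ _ wP) Gm; apply/(truncB _ _ w'P).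
pose t := [ffun i : 'I_n => inord (minn (m i) B) : 'I_B.+1].
have boxt : box t = [multinom minn (m i) B | i < n]%MM.
  by apply/mnmP => i; rewrite !mnmE ffunE inordK // ltnS geq_minr.
move: (eq_ww' t); rewrite !inE boxt => eq_t; apply/classical_boolP.
by rewrite -eq_t; apply/classical_boolP.
Qed.

Theorem theorem2p2 (k : fieldType) (r s : nat)
  (I : {mpoly k[r]} -> Prop) (J : {mpoly k[s]} -> Prop) (u : rat) :
  monomial_ideal I -> monomial_ideal J -> 0 < u ->
  same_ideal
    (rat_power (ideal_add (ideal_ext (@embA k r s) I) (ideal_ext (@embB k r s) J)) u)
    (rp_sum I J u)
  /\ exists ws : seq rat,
       (forall w, w \in ws -> 0 <= w <= u) /\
       (forall w : rat, 0 <= w <= u ->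
          exists2 w', w' \in ws & same_ideal (rp_term I J u w) (rp_term I J u w')).
Proof.
move=> [G IG] [H JH] /ltW u0; split=> [f|].
  by rewrite (monomial_rat_power (ideal_add_monomial IG JH)) (rp_sum_monomial IG JH).
have [TG [codeG codeGP]] := rat_below_finite G u.
have [TH [codeH codeHP]] := rat_below_finite H u.
(* The first code determines I_w and the second J_(u - w), as u - w also lies in [0, u]. *)
have [ws [wsP ws_rep]] := finite_representatives (fun w => 0 <= w <= u)
  (fun w => (codeG w, codeH (u - w))).
exists ws; split=> // w wP; have [w' w'ws [eqG eqH]] := ws_rep w wP.
have w'P := wsP _ w'ws; exists w'; first by [].
have compl v : 0 <= v <= u -> 0 <= u - v <= u.
  by case/andP=> v0 vu; rewrite subr_ge0 vu gerBl.
have [wP' w'P'] := (compl w wP, compl w' w'P).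
move=> f; split; apply: (rp_term_sub IG JH).
- exact: codeGP.
- exact: codeHP.
- exact: codeGP.
- exact: codeHP.
Qed.
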